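(* Let $L$ be a frame with pointless part $E$. The following are equivalent. (1) For all $b\in L$, $\{c\in L:c\ge b\}=\bigcap\{x_a: a\in\max L,\ b\nleq a\}$ (equivalently, $\bigcap\{x_a:a\in\max L,\ b\in x_a\}$). (2) For all $b\in L$, $b=\bigwedge\{a\in\max L: b\le a\}$, i.e., $L$ is spatial. (3) For all $b\in E$, $b=\bigwedge\{a\in\max L:b\le a\}$. When these conditions hold, then for all $b\in E$, $\{c\in E:c\ge b\}=\bigcap\{y_a:a\in\max L,\ b\nleq a\}$.
   Context: All frames are completely regular. $\max L$ is the set of maximal elements of $L\setminus\{\top\}$. An element $c$ is a successor of $a$ if $c>a$ and there is no $b$ with $a<b<c$. The pointless part of $L$ is $E=\pi L=\{a\in L:a\text{ has no successor}\}$, regarded as a subset (sublocale) of $L$. For $a\in\max L$, $x_a=\{b\in L:b\nleq a\}$ and $y_a=\{b\in E:b\nleq a\}$. Meets are taken in $L$; the empty meet is $\top$; the intersection of the empty family of subsets of $L$ (respectively $E$) is $L$ (respectively $E$). *)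

(* Defs.v *)
From HB Require Import structures.
From mathcomp Require Import all_boot all_order all_algebra.
From mathcomp Require Import boolp classical_sets.

Set Implicit Arguments.
Unset Strict Implicit.
Unset Printing Implicit Defensive.

Import Order.TTheory.
Local Open Scope classical_set_scope.
Local Open Scope order_scope.

HB.mixin Record TBLattice_isFrame (d : Order.disp_t) T
    of Order.TBLattice d T := {
  bigjoin : set T -> T;
  bigjoin_ub : forall A : set T, ubound A (bigjoin A);
  bigjoin_least : forall (A : set T) b, ubound A b -> bigjoin A <= b;
  meet_bigjoin : forall a (A : set T),
    (a `&` bigjoin A)%O = bigjoin [set (a `&` b)%O | b in A]
}.

#[short(type="frameType")]
HB.structure Definition Frame (d : Order.disp_t) :=
  { T of TBLattice_isFrame d T & Order.TBLattice d T }.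

Section FrameNotions.
Variables (d : Order.disp_t) (L : frameType d).
Implicit Types (a b c : L).

(* The meet of the empty set is \top, since every element is a lower bound. *)
Definition bigmeet (A : set L) : L := bigjoin (lbound A).

Definition pseudocompl a : L := bigjoin [set c | (c `&` a)%O = \bot].

Definition rather_below a b : Prop := (pseudocompl a `|` b)%O = \top.

(* The interpolating scale is indexed by the rationals of [0, 1]. *)
Definition completely_below a b : Prop :=
  exists c : rat -> L,
    [/\ c 0%R = a, c 1%R = b &
        forall p q : rat, (0 <= p)%R -> (p < q)%R -> (q <= 1)%R ->
          rather_below (c p) (c q)].

Definition completely_regular : Prop :=
  forall a, a = bigjoin [set b | completely_below b a].

Definition maxL : set L :=
  [set a | a <> \top /\ forall b, b <> \top -> a <= b -> b = a].

Definition successor a c : Prop := a < c /\ ~ exists b, a < b /\ b < c.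

Definition pointless_part : set L := [set a | ~ exists c, successor a c].

Definition xset a : set L := [set b | ~ b <= a].

Definition yset a : set L := [set b | pointless_part b /\ ~ b <= a].

(* A point of a frame, presented as a completely prime filter: the inverse
   image of the top element under a frame homomorphism to the frame {0, 1}. *)
Definition completely_prime_filter (F : set L) : Prop :=
  [/\ F \top,
      forall a b, a <= b -> F a -> F b,
      forall a b, F a -> F b -> F (a `&` b)%O &
      forall A : set L, F (bigjoin A) -> exists2 a, A a & F a].

(* L has enough points. *)
Definition spatial : Prop :=
  forall a b, (forall F, completely_prime_filter F -> F a -> F b) -> a <= b.

End FrameNotions.

Arguments completely_regular {d} L.
Arguments maxL {d} L.
Arguments pointless_part {d} L.
Arguments spatial {d} L.

(* Main.v *)
Require Import Defs.
From HB Require Import structures.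
From mathcomp Require Import all_boot all_order all_algebra.
From mathcomp Require Import boolp classical_sets.

Set Implicit Arguments.
Unset Strict Implicit.
Unset Printing Implicit Defensive.

Import Order.TTheory.
Local Open Scope classical_set_scope.
Local Open Scope order_scope.

(** The description of principal filters by the sets [xset a], the
    decomposition of every element as a meet of maximal ones, and spatiality all
    say, in different words, that an inequality [b <= c] can be tested on the
    maximal elements above [c]; this common form is [max_detects_le] below.
    Spatiality takes this form because the complement of a completely prime
    filter is the principal ideal of a prime element, and primes are the same as
    maximal elements in a regular frame ([prime_max], [max_prime]).

    The substance is the passage from the pointless part to the whole frame.
    Two facts carry it.  If [c] is a successor of [e], then the Heyting
    implication [c -> e] is prime, hence maximal ([successor_himp_max]), so that
    a maximal element accounts for every failure to be pointless.  Now suppose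
    that [b] lies below every maximal element above [c], and put [e = b -> c].
    A successor [f] of [e] would produce a maximal [a = f -> e] above [c], hence
    above [b]; then [f /\ b] lies below [a /\ f <= e], which forces [f <= e].
    So [e] is pointless ([pointless_himp]).  If pointless elements are meets of
    maximal ones, those above [e] lie above [c], hence above [b], and so
    [b <= e = (b -> c)], that is, [b <= c]. *)

(** * Adjunction and distributivity in a frame *)

Section Frames.
Variables (d : Order.disp_t) (L : frameType d).
Implicit Types (a b c e p x y : L) (A : set L).

Lemma le_bigmeet A x : x <= bigmeet A <-> lbound A x.
Proof.
split=> [xA a Aa|xA]; last exact: bigjoin_ub.
by apply: le_trans xA _; apply: bigjoin_least => y; apply.
Qed.

Lemma meet_bigjoin_le a A c :
  (forall x, A x -> a `&` x <= c) -> a `&` bigjoin A <= c.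
Proof.
by move=> Ac; rewrite meet_bigjoin; apply: bigjoin_least => _ [x Ax <-]; exact: Ac.
Qed.

Definition himp b c : L := bigjoin [set x | x `&` b <= c].

Lemma le_himp x b c : x <= himp b c <-> x `&` b <= c.
Proof.
split=> [xbc|]; last by move=> ?; exact: bigjoin_ub.
have h : b `&` himp b c <= c by apply: meet_bigjoin_le => y; rewrite meetC.
by apply: le_trans h; rewrite meetC; exact: leI2.
Qed.

(** Binary distributivity is not part of the lattice structure underlying a
    frame; it follows from the adjunction, in this inequational form. *)
Lemma meet_join_le x y a c :
  x `&` a <= c -> y `&` a <= c -> (x `|` y) `&` a <= c.
Proof. by move=> /le_himp xc /le_himp yc; apply/le_himp; rewrite leUx xc. Qed.

(** * Prime and maximal elements *)

Definition prime_elt p : Prop :=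
  p <> \top /\ forall x y, x `&` y <= p -> x <= p \/ y <= p.

Lemma max_join_top a x : maxL L a -> ~ x <= a -> x `|` a = \top.
Proof.
move=> [_ amax] xa; apply: contrapT => /amax /(_ (leUr _ _)) xaE.
by apply: xa; rewrite -xaE leUl.
Qed.

(** If [x] and [y] both join with [a] to the top, so does their meet, by
    distributivity. *)
Lemma max_prime a : maxL L a -> prime_elt a.
Proof.
move=> am; split=> [|x y xya]; first by case: am.
have [xa|xa] := pselect (x <= a); [by left | right].
rewrite -[y]meet1x -(max_join_top am xa).
by apply: meet_join_le => //; rewrite leIl.
Qed.

Lemma completely_below_rather_below a b :
  completely_below a b -> rather_below a b.
Proof. by case=> c [<- <-]; apply. Qed.

Lemma pseudocompl_meet a : a `&` pseudocompl a <= \bot.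
Proof. by apply: meet_bigjoin_le => x /= xa; rewrite meetC xa. Qed.

(** This is the only place where regularity enters.  If [p < q] with [p] prime,
    some [z] rather below [q] is not below [p]; as [z] meets its
    pseudocomplement in the bottom, the pseudocomplement is below [p], hence
    below [q], and so [q] is the top. *)
Lemma prime_max p : completely_regular L -> prime_elt p -> maxL L p.
Proof.
move=> reg [pN1 pp]; split=> // q qN1 pq.
apply: le_anti; rewrite pq andbT [leLHS]reg.
apply: bigjoin_least => z /completely_below_rather_below zq.
have [//|zp] := pp z _ (le_trans (pseudocompl_meet z) (le0x p)).
by case: qN1; rewrite -zq; apply/esym/join_idPr/(le_trans zp).
Qed.

(** * Completely prime filters *)

(** The prime element attached to a completely prime filter is the join of its
    complement. *)
Definition cofilter_join (F : set L) : L := bigjoin (~` F).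

Lemma le_cofilter_join (F : set L) x :
  completely_prime_filter F -> x <= cofilter_join F <-> ~ F x.
Proof.
case=> _ Fup _ Fjoin; split=> [xp Fx|Fx]; last exact: bigjoin_ub.
by have [] := Fjoin _ (Fup _ _ xp Fx).
Qed.

Lemma cofilter_join_prime (F : set L) :
  completely_prime_filter F -> prime_elt (cofilter_join F).
Proof.
move=> cF; have [F1 _ Fmeet _] := cF; split=> [p1|x y].
  by have /(le_cofilter_join _ cF) : \top <= cofilter_join F by rewrite p1.
move=> /(le_cofilter_join _ cF) Fxy.
have [Fx|Fx] := pselect (F x); last by left; apply/(le_cofilter_join _ cF).
by right; apply/(le_cofilter_join _ cF) => Fy; exact/Fxy/Fmeet.
Qed.

Lemma prime_filter p : prime_elt p -> completely_prime_filter (xset p).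
Proof.
move=> [pN1 pp]; split=> [p1|a b ab ap bp|a b ap bp /pp[]//|A Ap].
- by apply/pN1/le_anti; rewrite lex1.
- exact/ap/(le_trans ab).
- apply: contrapT => nA; apply/Ap/bigjoin_least => a Aa.
  by apply: contrapT => ap; apply: nA; exists a.
Qed.

(** * Detecting the order on maximal elements *)

(** Free of infinite meets and of filters, this is the form in which the
    conditions are compared with one another. *)
Definition max_detects_le : Prop :=
  forall b c, (forall a, maxL L a -> c <= a -> b <= a) -> b <= c.

Lemma le_max_meet b c :
  b <= bigmeet [set a | maxL L a /\ c <= a] <->
  forall a, maxL L a -> c <= a -> b <= a.
Proof.
split=> [/le_bigmeet h a am ca|h]; first exact: h.
by apply/le_bigmeet => a [am ca]; exact: h.
Qed.

Lemma max_detects_le_meet :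
  max_detects_le <-> forall b, b = bigmeet [set a | maxL L a /\ b <= a].
Proof.
split=> [D b|M b c bc]; last by rewrite (M c); exact/le_max_meet.
apply: le_anti; apply/andP; split; first exact/le_max_meet.
by apply: D; exact/le_max_meet.
Qed.

(** Contraposition turns avoiding the maximal elements not above [b] into the
    condition that every maximal element above [c] is above [b]. *)
Lemma bigcap_xset b c :
  (\bigcap_(a in [set a | maxL L a /\ ~ b <= a]) xset a) c <->
  forall a, maxL L a -> c <= a -> b <= a.
Proof.
split=> [h a am ca|h a [am ba] ca]; last exact/ba/h.
by apply: contrapT => ba; exact: (h a).
Qed.

Lemma max_detects_le_upset :
  max_detects_le <-> forall b,
    [set c | b <= c] = \bigcap_(a in [set a | maxL L a /\ ~ b <= a]) xset a.
Proof.
split=> [D b|U b c /bigcap_xset]; last by rewrite -U.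
apply/seteqP; split=> c /=; last by move=> /bigcap_xset; exact: D.
by move=> bc; apply/bigcap_xset => a _; exact: le_trans.
Qed.

Lemma max_detects_le_spatial :
  completely_regular L -> max_detects_le <-> spatial L.
Proof.
move=> reg; split=> [D b c bc|S b c bc].
  apply: D => a am ca; apply: contrapT => ba.
  exact: (bc _ (prime_filter (max_prime am)) ba).
apply: S => F cF; apply: contraPP => /(le_cofilter_join _ cF) cp.
apply/(le_cofilter_join _ cF)/bc => //.
exact: prime_max reg (cofilter_join_prime cF).
Qed.

(** * The pointless part *)

(** If [x] is not below [c -> e], then [x /\ c] is not below [e], so its join
    with [e] is all of [c]: nothing lies strictly between [e] and [c].  A [y]
    with [x /\ y <= (c -> e)] then satisfies [y /\ c <= e] by distributivity. *)
Lemma successor_himp_prime e c : successor e c -> prime_elt (himp c e).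
Proof.
move=> [ec gap]; split=> [p1|x y /le_himp xyc].
  have : \top <= himp c e by rewrite p1.
  by move=> /le_himp; rewrite meet1x (lt_geF ec).
have [xc|xc] := pselect (x `&` c <= e); [by left; apply/le_himp | right].
have cE : (x `&` c) `|` e = c.
  apply: contrapT => cN; apply: gap; exists ((x `&` c) `|` e); split.
    rewrite lt_neqAle leUr andbT; apply/eqP => eE.
    by apply: xc; rewrite [leRHS]eE leUl.
  by rewrite lt_neqAle leUx leIr (ltW ec) !andbT; apply/eqP.
apply/le_himp; rewrite meetC -cE; apply: meet_join_le; last exact: leIl.
by rewrite meetAC.
Qed.

Lemma successor_himp_max e c :
  completely_regular L -> successor e c -> maxL L (himp c e).
Proof. by move=> reg /successor_himp_prime /(prime_max reg). Qed.

Lemma pointless_himp b c : completely_regular L ->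
  (forall a, maxL L a -> c <= a -> b <= a) -> pointless_part L (himp b c).
Proof.
move=> reg bc [f ef]; have am := successor_himp_max reg ef.
have ce : c <= himp b c by apply/le_himp; exact: leIl.
have /le_himp : b <= himp f (himp b c).
  by apply: bc am _; apply/le_himp; apply: le_trans ce; exact: leIl.
(* [b /\ f <= (b -> c)] gives [f /\ b <= c] because [b] occurs twice. *)
move=> /le_himp; rewrite meetAC meetxx meetC => /le_himp fe.
by case: ef => /lt_geF; rewrite fe.
Qed.

Lemma pointless_max_detects_le : completely_regular L ->
  (forall b, pointless_part L b -> b = bigmeet [set a | maxL L a /\ b <= a]) ->
  max_detects_le.
Proof.
move=> reg M b c bc.
suff /le_himp : b <= himp b c by rewrite meetxx.
rewrite (M _ (pointless_himp reg bc)); apply/le_max_meet => a am ea.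
by apply: bc am _; apply: le_trans ea; apply/le_himp; exact: leIl.
Qed.

Lemma pointless_bigcap_yset (I : set L) :
  (pointless_part L `&` \bigcap_(a in I) yset a)%classic =
  (pointless_part L `&` \bigcap_(a in I) xset a)%classic.
Proof.
by apply/seteqP; split=> c [cE h]; split=> // a Ia; [case: (h a Ia)|split; [|exact: h]].
Qed.

End Frames.

Theorem proposition7p1p2 (d : Order.disp_t) (L : frameType d)
    (HL : completely_regular L) :
  [/\ (* (1), (2) and (3) are equivalent *)
      [<-> forall b : L,
             [set c | b <= c] =
             \bigcap_(a in [set a | maxL L a /\ ~ b <= a]) xset a;
           forall b : L, b = bigmeet [set a | maxL L a /\ b <= a];
           forall b : L, pointless_part L b ->
             b = bigmeet [set a | maxL L a /\ b <= a]],
      (* the alternative form of (1) *)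
      (forall b : L,
         [set c | b <= c] =
         \bigcap_(a in [set a | maxL L a /\ ~ b <= a]) xset a) <->
      (forall b : L,
         [set c | b <= c] =
         \bigcap_(a in [set a | maxL L a /\ xset a b]) xset a),
      (* (2) says that L is spatial *)
      (forall b : L, b = bigmeet [set a | maxL L a /\ b <= a]) <-> spatial L
    & (* the consequence for E; the intersection is taken inside E *)
      (forall b : L, b = bigmeet [set a | maxL L a /\ b <= a]) ->
      forall b : L, pointless_part L b ->
        [set c | pointless_part L c /\ b <= c] =
        (pointless_part L `&`
         \bigcap_(a in [set a | maxL L a /\ ~ (b <= a)%O]) yset a)%classic].
Proof.
split.
- tfae.
  + by move=> /max_detects_le_upset /max_detects_le_meet.
  + by [].
  + by move=> /(pointless_max_detects_le HL) /max_detects_le_upset.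
- by [].
- split; first by move=> /max_detects_le_meet /(max_detects_le_spatial HL).
  by move=> /(max_detects_le_spatial HL) /max_detects_le_meet.
- move=> /max_detects_le_meet /max_detects_le_upset U b _.
  by rewrite pointless_bigcap_yset -U.
Qed.
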